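(* Let $G$ be a connected half-transitive multigraph with bipartition $V_1\cup V_2$. Assume each vertex in $V_1$ has degree $d_1$, each vertex in $V_2$ has degree $d_2$ in $G$, and $|V(G)|\geq 2\min\{d_1,d_2\}+2$. Then $G$ is not super edge-connected if and only if there is a proper induced connected half-transitive multi-subgraph $H$ of $G$, with $A_1=V_1\cap V(H)$ and $A_2=V_2\cap V(H)$ both non-empty, such that $$d_1'<d_1,\quad d_2'<d_2\quad\text{and}\quad |A_1|(d_1-d_1')+|A_2|(d_2-d_2')\leq \min\{d_1,d_2\},$$ where $d_1'$ is the degree in $H$ of each vertex of $A_1$ and $d_2'$ is the degree in $H$ of each vertex of $A_2$.
   Context: Graphs are finite. A multigraph may have multiple edges but has no loops (simple graphs are allowed); the degree of a vertex counts edges with multiplicity. An automorphism of a multigraph is a permutation of its vertex set preserving the number of edges between every pair of vertices. A bipartite multigraph with bipartition $V_1\cup V_2$ (both parts non-empty) is half-transitive if its automorphism group acts transitively both on $V_1$ and on $V_2$, i.e. for each $i\in\{1,2\}$ and all $u,v\in V_i$ there is an automorphism $\alpha$ with $\alpha(u)=v$. All vertices in the same part then have the same degree. For an induced multi-subgraph $H$ of $G$, half-transitivity is with respect to the bipartition $(V_1\cap V(H))\cup(V_2\cap V(H))$; proper induced means $H=G[A]$ for some $A\subsetneq V(G)$, all edges of $G$ between vertices of $A$ being kept with their multiplicities. The edge-connectivity $\lambda(G)$ is the minimum number of edges (counted with multiplicity) whose removal disconnects $G$; a minimum edge-cut is a disconnecting edge set of size $\lambda(G)$. $G$ is super edge-connected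 if every minimum edge-cut isolates a vertex, i.e. is the set of edges incident with some vertex of $G$. *)

(* Defs.v *)
From mathcomp Require Import all_boot all_fingroup.

Set Implicit Arguments.
Unset Strict Implicit.
Unset Printing Implicit Defensive.

(* Edges are objects in their own right, so that an edge set counts parallel
   edges with multiplicity; two distinct ends means that there are no loops. *)
Record mgraph := MGraph {
  vertex : finType;
  edge : finType;
  ends : edge -> {set vertex};
  card_ends : forall e, #|ends e| = 2 }.

Section Basics.
Variable G : mgraph.
Implicit Types (x y v : vertex G) (F : {set edge G}) (A : {set vertex G}).

Definition mult x y : nat := #|[set e : edge G | ends e == [set x; y]]|.

Definition incident_edges v : {set edge G} := [set e | v \in ends e].

Definition degree v : nat := #|incident_edges v|.

(* adjacency in G - F *)
Definition adj_del F : rel (vertex G) :=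
  fun x y => [exists e, (e \notin F) && (ends e == [set x; y])].

Definition connected_del F : bool :=
  [forall x, forall y, connect (adj_del F) x y].

Definition mg_connected : bool := connected_del set0.

Definition disconnecting F : bool := ~~ connected_del F.

(* When G has at least two vertices, the set of all edges is disconnecting, so
   the default value #|edge G| does not affect the minimum. *)
Definition edge_connectivity : nat :=
  \big[minn/#|edge G|]_(F : {set edge G} | disconnecting F) #|F|.

Definition min_edge_cut F : Prop :=
  disconnecting F /\ #|F| = edge_connectivity.

Definition super_edge_connected : Prop :=
  forall F, min_edge_cut F -> exists v, F = incident_edges v.

Definition automorphism (s : {perm vertex G}) : Prop :=
  forall x y, mult (s x) (s y) = mult x y.

Definition aut_transitive_on A : Prop :=
  forall x y, x \in A -> y \in A -> exists2 s, automorphism s & s x = y.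

Definition bipartition (V1 V2 : {set vertex G}) : Prop :=
  [/\ V1 != set0, V2 != set0, V1 :|: V2 = [set: vertex G], [disjoint V1 & V2]
    & forall e : edge G,
        exists x y, [/\ x \in V1, y \in V2 & ends e = [set x; y]]].

Definition half_transitive (V1 V2 : {set vertex G}) : Prop :=
  [/\ bipartition V1 V2, aut_transitive_on V1 & aut_transitive_on V2].

End Basics.

Section Induced.
Variables (G : mgraph) (A : {set vertex G}).

Definition ind_vertex : finType := {x : vertex G | x \in A}.
Definition ind_edge : finType := {e : edge G | ends e \subset A}.

Definition ind_part (B : {set vertex G}) : {set ind_vertex} :=
  [set x | val x \in B].

Definition ind_ends (e : ind_edge) : {set ind_vertex} :=
  ind_part (ends (val e)).

Lemma card_ind_ends e : #|ind_ends e| = 2.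
Proof.
rewrite -(card_ends (val e)) -(card_imset _ val_inj).
apply: eq_card => x; apply/imsetP/idP => [[y] | xe].
  by rewrite inE => ye ->.
by exists (Sub x (subsetP (valP e) x xe)); rewrite ?inE SubK.
Qed.

Definition induced : mgraph := MGraph card_ind_ends.

End Induced.

(* Main.v *)
Require Import Defs.
From mathcomp Require Import all_boot all_fingroup.
From mathcomp Require Import zify.

(** An edge cut is treated as the boundary of a vertex set: a minimum edge cut is
    exactly a boundary of minimum size, because removing a disconnecting set [F]
    leaves a component whose boundary lies in [F].

    If [G] is not super edge-connected, some minimum boundary has at least two
    vertices on each side; a smallest set [A] with such a boundary is called a
    superatom.  By minimality and the submodularity of the boundary size, two
    superatoms that overlap meet in one vertex and differ by one vertex, and all
    four pieces cut out by them have minimum boundaries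
    ([superatom_meet]).  Hence either the images of [A] under automorphisms are
    equal to [A] or disjoint from it, or [A] is a pair of vertices of minimum
    degree ([superatom_block_or_pair]).  In the first case automorphisms that
    move a vertex of [A] into [A] stabilise [A], so they restrict to
    automorphisms of [G[A]]; in the second case each part of [G[A]] is a single
    vertex.  Either way [G[A]] is half-transitive
    ([superatom_half_transitive]).  It is connected, since otherwise the boundary
    of [A] would be the disjoint union of two boundaries.  Counting the boundary
    by its ends in [A] gives
    |A1| (d1 - d1') + |A2| (d2 - d2') ([card_boundary_regular]), which is the edge
    connectivity and so at most the minimum degree; the strict inequalities
    di' < di say that every vertex of [A] has an edge leaving [A]
    ([superatom_out_edges]).

    Conversely, let [A] satisfy the conditions.  Its boundary has at most
    min(d1, d2) edges.  If [G] were super edge-connected, the edge connectivity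
    would be the degree of a vertex, so the boundary would be a minimum cut, and
    therefore the set of edges at a vertex [w].  As every vertex of [A] has an edge
    in it, [w] would be adjacent to vertices of both parts
    ([boundary_not_incident]). *)

Set Implicit Arguments.
Unset Strict Implicit.
Unset Printing Implicit Defensive.

(** * Boundaries of vertex sets *)

Section Cuts.
Variable G : mgraph.
Implicit Types (u v w x y : vertex G) (e : edge G) (F : {set edge G}).
Implicit Types (A B X Y : {set vertex G}) (s : {perm vertex G}).

(** The form of the definition makes the symmetry between [A] and its complement
    immediate; [in_boundary] is the exclusive or used in every computation. *)
Definition boundary A : {set edge G} :=
  [set e | ~~ (ends e \subset A) && ~~ (ends e \subset ~: A)].

Lemma ends_pair e : exists x y, x != y /\ ends e = [set x; y].
Proof.
have /cards2P[x [y [xy De]]] : #|ends e| == 2 by rewrite card_ends.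
by exists x, y.
Qed.

Lemma in_boundary e x y A :
  ends e = [set x; y] -> (e \in boundary A) = (x \in A) (+) (y \in A).
Proof.
by move=> De; rewrite inE De !subUset !sub1set !inE; do 2!case: (_ \in A).
Qed.

Lemma neq_setT A x : x \notin A -> A != setT.
Proof. by apply: contraNneq => ->; rewrite inE. Qed.

Lemma neq_set0 A x : x \in A -> A != set0.
Proof. by move=> xA; apply/set0Pn; exists x. Qed.

Lemma boundaryC A : boundary (~: A) = boundary A.
Proof. by apply/setP=> e; rewrite !inE setCK andbC. Qed.

Lemma boundary1 v : boundary [set v] = incident_edges v.
Proof.
apply/setP=> e; have [x [y [xy De]]] := ends_pair e.
rewrite (in_boundary _ De) !inE De !inE ![v == _]eq_sym.
by case: eqP => [xv|] //=; case: eqP => // yv; rewrite xv yv eqxx in xy.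
Qed.

Lemma card_edges F : #|F| = \sum_e (e \in F).
Proof. by rewrite -sum1_card big_mkcond; apply: eq_bigr => e _; case: (_ \in _). Qed.

(** Edge by edge, this is a check over the four regions that can hold each end. *)
Lemma boundary_submodular A B :
  #|boundary (A :&: B)| + #|boundary (A :|: B)| <= #|boundary A| + #|boundary B|.
Proof.
rewrite !card_edges -!big_split; apply: leq_sum => e _ /=.
have [x [y [_ De]]] := ends_pair e; rewrite !(in_boundary _ De) !inE.
by do 2!case: (_ \in A); do 2!case: (_ \in B).
Qed.

(** Submodularity of [A] and the complement of [B], since complementary sets have
    the same boundary. *)
Lemma boundary_posimodular A B :
  #|boundary (A :\: B)| + #|boundary (B :\: A)| <= #|boundary A| + #|boundary B|.
Proof.
have := boundary_submodular A (~: B).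
by rewrite -setDE -(boundaryC (_ :|: _)) setCU setCK setIC -setDE boundaryC.
Qed.

(** * Cuts and connectivity *)

Lemma boundary_disconnecting F X :
  X != set0 -> X != setT -> boundary X \subset F -> disconnecting F.
Proof.
move=> /set0Pn[x xX]; rewrite -subTset => /subsetPn[y _ yX] /subsetP sXF.
apply/negP=> /forallP/(_ x)/forallP/(_ y).
have clX : closed (adj_del F) X.
  move=> u v /existsP[e /andP[eF /eqP De]].
  apply/eqP; apply: contraR eF => uv; apply: sXF; rewrite (in_boundary _ De).
  by move: uv; case: (u \in X); case: (v \in X).
by move=> /(closed_connect clX); rewrite xX (negPf yX).
Qed.

(** [X] is a connected component of the graph without [F]. *)
Lemma disconnecting_boundary F : disconnecting F ->
  exists X, [/\ X != set0, X != setT & boundary X \subset F].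
Proof.
rewrite /disconnecting negb_forall => /existsP[x].
rewrite negb_forall => /existsP[y xy].
exists [set z | connect (adj_del F) x z]; split.
- by apply: (@neq_set0 _ x); rewrite inE connect0.
- by apply: (@neq_setT _ y); rewrite inE.
apply/subsetP=> e; have [u [v [_ De]]] := ends_pair e.
rewrite (in_boundary _ De) !inE; apply: contraLR => eF; apply/negP.
have uv : adj_del F u v by apply/existsP; exists e; rewrite eF De eqxx.
have vu : adj_del F v u by apply/existsP; exists e; rewrite eF De setUC eqxx.
have -> : connect (adj_del F) x u = connect (adj_del F) x v; last by rewrite addbb.
by apply/idP/idP => /connect_trans; apply; apply: connect1.
Qed.

Lemma connectivity_le_disconnecting F :
  disconnecting F -> edge_connectivity G <= #|F|.
Proof.
move=> dF; rewrite /edge_connectivity.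
have : F \in index_enum {set edge G} by rewrite mem_index_enum.
elim: (index_enum _) => //= F' r IHr; rewrite inE big_cons => /orP[/eqP<-|/IHr le].
  by rewrite dF geq_minl.
by case: ifP => // _; rewrite geq_min le orbT.
Qed.

Lemma connectivity_le_boundary X :
  X != set0 -> X != setT -> edge_connectivity G <= #|boundary X|.
Proof.
move=> X0 XT; apply: connectivity_le_disconnecting.
exact: boundary_disconnecting X0 XT _.
Qed.

(** Two distinct vertices make the edge connectivity a genuine minimum, attained by
    a disconnecting set, instead of the default value of its definition. *)
Lemma min_edge_cut_exists x y : x != y -> exists F, min_edge_cut (F : {set edge G}).
Proof.
move=> xy; have dT : disconnecting [set: edge G].
  apply: (@boundary_disconnecting _ [set x]); rewrite ?subsetT //.
    by apply: (@neq_set0 _ x); rewrite inE.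
  by apply: (@neq_setT _ y); rewrite inE eq_sym.
case: (arg_minnP (fun F : {set edge G} => #|F|) dT) => F dF minF.
exists F; split=> //; apply/eqP; rewrite eqn_leq connectivity_le_disconnecting // andbT.
by apply: (big_ind (fun n => #|F| <= n)); rewrite ?max_card // => m n; rewrite leq_min => ->.
Qed.

Lemma connectivity_gt0 x y :
  x != y -> mg_connected G -> 0 < edge_connectivity G.
Proof.
move=> /min_edge_cut_exists[F [dF <-]] conG; rewrite lt0n cards_eq0.
by apply: contraL conG => /eqP F0; rewrite /mg_connected -F0.
Qed.

(** A minimum cut contains a boundary, which is itself disconnecting, so the two
    have the same size. *)
Lemma min_edge_cut_boundary F : min_edge_cut F ->
  exists X, [/\ X != set0, X != setT & F = boundary X].
Proof.
case=> dF cF; have [X [X0 XT sXF]] := disconnecting_boundary dF.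
exists X; split=> //; apply/esym/eqP.
by rewrite eqEcard sXF cF connectivity_le_boundary.
Qed.

(** * Counting edges through the vertices *)

Definition out_edges A x := incident_edges x :&: boundary A.

Lemma card_boundary_out A : #|boundary A| = \sum_(x in A) #|out_edges A x|.
Proof.
under eq_bigr do rewrite card_edges.
rewrite exchange_big card_edges; apply: eq_bigr => e _ /=.
have [x [y [xy De]]] := ends_pair e.
under eq_bigr do rewrite in_setI (in_boundary _ De) inE De !inE.
rewrite (in_boundary _ De).
have [xA|xA] := boolP (x \in A); have [yA|yA] := boolP (y \in A) => /=.
- by rewrite big1 // => i _; rewrite andbF.
- rewrite (bigD1 x) //= eqxx /= big1 // => i /andP[iA ix].
  by rewrite (negPf ix) (_ : i == y = false) //; apply: contraNF yA => /eqP<-.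
- rewrite (bigD1 y) //= eqxx orbT /= big1 // => i /andP[iA iy].
  by rewrite (negPf iy) (_ : i == x = false) //; apply: contraNF xA => /eqP<-.
- by rewrite big1 // => i _; rewrite andbF.
Qed.

Lemma eq_set2l x y z : ([set x; y] == [set x; z]) = (y == z).
Proof.
apply/eqP/eqP=> [E|->//].
have: y \in [set x; z] by rewrite -E !inE eqxx orbT.
have: z \in [set x; y] by rewrite E !inE eqxx orbT.
by rewrite !inE => /orP[]/eqP-> /orP[]/eqP.
Qed.

Lemma card_out_edges A x : x \in A ->
  #|out_edges A x| = \sum_(y | y \notin A) mult x y.
Proof.
move=> xA.
under eq_bigr do (rewrite /mult card_edges; under eq_bigr do rewrite inE).
rewrite exchange_big card_edges; apply: eq_bigr => e _ /=.
rewrite in_setI inE; have [xe|xe] := boolP (x \in ends e); last first.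
  by rewrite big1 // => y _; case: eqP => // De; rewrite De !inE eqxx in xe.
have [z De] : exists z, ends e = [set x; z].
  have [u [v [_ De]]] := ends_pair e; move: xe; rewrite De !inE.
  by case/orP=> /eqP->; [exists v | exists u; rewrite setUC].
rewrite (in_boundary _ De) De xA /=.
under eq_bigr do rewrite eq_set2l.
have [zA|zA] /= := boolP (z \in A).
  by rewrite big1 // => y yA; case: eqP => // zy; rewrite -zy zA in yA.
by rewrite (bigD1 z) //= eqxx big1 // => y /andP[_]; rewrite eq_sym => /negPf->.
Qed.

(** Automorphisms permute vertices only and preserve multiplicities, so the
    boundary has to be counted through multiplicities for its size to be seen to be
    invariant. *)
Lemma card_boundary_aut s A :
  automorphism s -> #|boundary (s @: A)| = #|boundary A|.
Proof.
move=> auts; rewrite !card_boundary_out (reindex_inj (@perm_inj _ s)) /=.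
apply: eq_big => [x|x]; rewrite (mem_imset _ _ (@perm_inj _ s)) // => xA.
rewrite !card_out_edges ?(mem_imset _ _ (@perm_inj _ s)) //.
rewrite (reindex_inj (@perm_inj _ s)) /=.
by apply: eq_big => [y|y _]; rewrite ?auts // (mem_imset _ _ (@perm_inj _ s)).
Qed.

Lemma degree_aut s x : automorphism s -> degree (s x) = degree x.
Proof.
by move=> auts; have := card_boundary_aut [set x] auts; rewrite imset_set1 !boundary1.
Qed.

Lemma out_edgesP A x : x \in A ->
  reflect (exists2 y, y \notin A & 0 < mult x y) (0 < #|out_edges A x|).
Proof.
move=> xA; rewrite card_out_edges // lt0n sum_nat_eq0 negb_forall.
apply: (iffP existsP) => -[y].
  by rewrite negb_imply -lt0n => /andP[]; exists y.
by exists y; rewrite negb_imply -lt0n; apply/andP.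
Qed.

Lemma boundary_neq0 x y A :
  mg_connected G -> x \in A -> y \notin A -> boundary A != set0.
Proof.
move=> conG xA yA; apply: contraL conG => /eqP A0.
apply: (@boundary_disconnecting _ A); rewrite ?A0 ?subxx //.
  exact: neq_set0 xA.
exact: neq_setT yA.
Qed.

Lemma boundary_exit A : boundary A != set0 ->
  exists u w, [/\ u \in A, w \notin A & 0 < mult u w].
Proof.
rewrite -card_gt0 card_boundary_out lt0n sum_nat_eq0 negb_forall => /existsP[u].
rewrite negb_imply -lt0n => /andP[uA /(out_edgesP uA)[w wA uw]].
by exists u, w.
Qed.

(** * Superatoms *)

(** The boundaries of these sets are the minimum cuts that do not visibly isolate a
    vertex. *)
Definition nontrivial_cut A :=
  [&& #|boundary A| == edge_connectivity G, 1 < #|A| & 1 < #|~: A|].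

Definition superatom A :=
  nontrivial_cut A /\ forall B, nontrivial_cut B -> #|A| <= #|B|.

(** A block of imprimitivity of the automorphism group, except that this group need
    not be transitive. *)
Definition aut_block A :=
  forall s, automorphism s -> ~~ [disjoint s @: A & A] -> s @: A = A.

Lemma superatom_exists : ~ super_edge_connected G -> exists A, superatom A.
Proof.
move=> nsuper; case: (pickP nontrivial_cut) => [A0 cA0 | no_cut].
  by case: (arg_minnP (fun A : {set vertex G} => #|A|) cA0) => A; exists A.
case: nsuper => F /[dup] minF /min_edge_cut_boundary[X [X0 XT DF]].
have star Y : Y != set0 -> F = boundary Y -> ~~ (1 < #|Y|) ->
    exists v, F = incident_edges v.
  rewrite -leqNgt => Y0 -> Y1; have /cards1P[v ->] : #|Y| == 1.
    by rewrite eqn_leq Y1 card_gt0.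
  by exists v; rewrite boundary1.
have := no_cut X; rewrite /nontrivial_cut -DF minF.2 eqxx /=.
case/negbT/nandP; apply: star; rewrite ?boundaryC //.
by move: XT; rewrite -subTset => /subsetPn[y _ yX]; apply: (@neq_set0 _ y); rewrite inE.
Qed.

Lemma superatom_aut s A : automorphism s -> superatom A -> superatom (s @: A).
Proof.
move=> auts [/and3P[cA A1 A1'] minA].
have cardsA := card_imset A (@perm_inj _ s).
split; last by rewrite cardsA.
rewrite /nontrivial_cut card_boundary_aut // cA cardsA A1.
by have := cardsC A; have := cardsC (s @: A); lia.
Qed.

Lemma superatom_card_leC A : superatom A -> #|A| <= #|~: A|.
Proof.
case=> /and3P[cA A1 A1'] minA; apply: minA.
by rewrite /nontrivial_cut boundaryC setCK cA A1' A1.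
Qed.

(** The complement of [X] is larger than that of [A], so a minimum boundary of [X]
    can fail to be nontrivial only by the size of [X]. *)
Lemma superatom_small A X : superatom A -> X != set0 -> #|X| < #|A| ->
  #|boundary X| = edge_connectivity G -> #|X| == 1.
Proof.
case=> /and3P[cA A1 A1'] minA X0 XA cX; rewrite eqn_leq card_gt0 X0 andbT leqNgt.
apply/negP=> X1; suff /minA : nontrivial_cut X by rewrite leqNgt XA.
rewrite /nontrivial_cut cX eqxx X1 /=.
by have := cardsC A; have := cardsC X; lia.
Qed.

(** [A] and [B] have at most half of the vertices each, so when they overlap the sets
    [A :&: B], [A :|: B], [A :\: B] and [B :\: A] are all nonempty and proper.
    Submodularity and posimodularity then make all four boundaries minimum, and
    [A :&: B] and [A :\: B] are smaller than the superatom [A], hence singletons. *)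
Lemma superatom_meet A B :
    superatom A -> superatom B -> ~~ [disjoint B & A] -> B != A ->
  exists v w, [/\ v != w, A = [set v; w], degree v = edge_connectivity G
                & degree w = edge_connectivity G].
Proof.
move=> sA sB; rewrite -setI_eq0 setIC => AB0 neqBA.
have cAB : #|A| = #|B|.
  by apply/eqP; rewrite eqn_leq (sA.2 _ sB.1) (sB.2 _ sA.1).
have leA := superatom_card_leC sA; have cC := cardsC A.
have cU := cardsUI A B; have cI := cardsID B A.
have DAB0 : A :\: B != set0.
  by apply: contra neqBA; rewrite setD_eq0 eq_sym eqEcard cAB leqnn andbT.
have DBA0 : B :\: A != set0.
  by apply: contra neqBA; rewrite setD_eq0 eqEcard cAB leqnn andbT.
have neqT X : #|X| < #|vertex G| -> X != setT.
  by apply: contraTneq => ->; rewrite cardsT ltnn.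
have I_gt0 : 0 < #|A :&: B| by rewrite card_gt0.
have D_gt0 : 0 < #|A :\: B| by rewrite card_gt0.
have cutA := eqP (andP sA.1).1; have cutB := eqP (andP sB.1).1.
have U0 : A :|: B != set0.
  by rewrite -card_gt0; lia.
have cBA : #|B :\: A| = #|A :\: B|.
  by have := cardsID A B; rewrite setIC; lia.
have subm := boundary_submodular A B; have posim := boundary_posimodular A B.
have lI : edge_connectivity G <= #|boundary (A :&: B)|.
  by apply: connectivity_le_boundary => //; apply: neqT; lia.
have lU : edge_connectivity G <= #|boundary (A :|: B)|.
  by apply: connectivity_le_boundary => //; apply: neqT; lia.
have lA : edge_connectivity G <= #|boundary (A :\: B)|.
  by apply: connectivity_le_boundary => //; apply: neqT; lia.
have lB : edge_connectivity G <= #|boundary (B :\: A)|.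
  by apply: connectivity_le_boundary => //; apply: neqT; lia.
have bI : #|boundary (A :&: B)| = edge_connectivity G by lia.
have bD : #|boundary (A :\: B)| = edge_connectivity G by lia.
have /cards1P[v Iv] : #|A :&: B| == 1 by apply: (superatom_small sA) => //; lia.
have /cards1P[w Dw] : #|A :\: B| == 1 by apply: (superatom_small sA) => //; lia.
exists v, w; rewrite /degree -!boundary1 -Iv -Dw setID bI bD; split=> //.
have /setIP[_ vB] : v \in A :&: B by rewrite Iv set11.
have /setDP[_ wB] : w \in A :\: B by rewrite Dw set11.
by apply: contraNneq wB => <-.
Qed.

(** Automorphisms map superatoms to superatoms, so a failure of the block property is
    an overlap of two of them. *)
Lemma superatom_block_or_pair A : superatom A ->
  aut_block A \/
  exists v w, [/\ v != w, A = [set v; w], degree v = edge_connectivity G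
                & degree w = edge_connectivity G].
Proof.
move=> sA; case: (pickP (fun s : {perm vertex G} =>
    [&& [forall x, forall y, mult (s x) (s y) == mult x y],
        ~~ [disjoint s @: A & A] & s @: A != A])) => [s|no_s].
  case/and3P=> /forallP auts sAA neq; right.
  apply: superatom_meet sAA neq => //; apply: superatom_aut => // x y.
  exact/eqP/(forallP (auts x)).
left=> s auts sAA; apply/eqP; have := no_s s; rewrite sAA /=.
suff -> : [forall x, forall y, mult (s x) (s y) == mult x y] by move/negbFE.
by apply/forallP=> x; apply/forallP=> y; rewrite auts.
Qed.

(** If no edge left [{v, w}] at [v], the boundary of the pair would consist of edges
    at [w]; having as many elements as the degree of [w], it would be the boundary of
    [w] alone, and [v] would be isolated. *)
Lemma pair_out_edges v w x : mg_connected G -> v != w ->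
    degree w = #|boundary [set v; w]| -> x \notin [set v; w] ->
  0 < #|out_edges [set v; w] v|.
Proof.
move=> conG vw dw xA; rewrite lt0n; apply/negP => /eqP v_out.
have cA := card_boundary_out [set v; w].
rewrite big_setU1 ?inE //= big_set1 v_out add0n in cA.
have bA : boundary [set v; w] = boundary [set w].
  have Dw : out_edges [set v; w] w = boundary [set v; w].
    by apply/eqP; rewrite eqEcard subsetIr cA leqnn.
  by apply/eqP; rewrite boundary1 eqEcard -[#|incident_edges w|]/(degree w) dw leqnn
     -Dw subsetIl.
have /negP[] : boundary [set v] != set0.
  by apply: (@boundary_neq0 v w); rewrite // inE // eq_sym.
apply/eqP/setP=> e; have [y [z [_ De]]] := ends_pair e.
have /setP/(_ e) := bA; rewrite !(in_boundary _ De) !inE.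
have nvw : (v == w) = false := negbTE vw.
have [->|_] := eqVneq y v; have [->|_] := eqVneq z v; rewrite ?nvw //=.
  by case: (z == w).
by case: (y == w).
Qed.

End Cuts.

(** * Superatoms in half-transitive graphs *)

Section HalfTransitive.
Variables (G : mgraph) (V1 V2 : {set vertex G}).
Hypothesis Ghalf : half_transitive V1 V2.
Implicit Types (u v w x y : vertex G) (A : {set vertex G}).

Lemma in_part2 x : (x \in V2) = (x \notin V1).
Proof.
have [[_ _ UT dis _] _ _] := Ghalf.
have := in_setT x; rewrite -UT inE.
have [xV1 _|//] := boolP (x \in V1).
exact: disjointFr dis xV1.
Qed.

Lemma mult_parts x y : 0 < mult x y -> (x \in V1) != (y \in V1).
Proof.
have [[_ _ _ _ bip] _ _] := Ghalf.
rewrite card_gt0 => /set0Pn[e]; rewrite inE => /eqP De.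
have [a [b [aV1 bV2 De']]] := bip e.
have bV1 : b \notin V1 by rewrite -in_part2.
have ab : a != b by apply: contraNneq bV1 => <-.
have : a \in [set x; y] by rewrite -De De' !inE eqxx.
have : b \in [set x; y] by rewrite -De De' !inE eqxx orbT.
rewrite !inE => /orP[]/eqP bE /orP[]/eqP aE; rewrite -?bE -?aE ?aV1 ?(negPf bV1) //.
- by rewrite aE bE eqxx in ab.
- by rewrite aE bE eqxx in ab.
Qed.

Lemma part_transitive x y : (x \in V1) = (y \in V1) ->
  exists2 s : {perm vertex G}, automorphism s & s x = y.
Proof.
have [_ t1 t2] := Ghalf; have [xV1 yV1|xV1 yV1] := boolP (x \in V1).
  exact: t1.
by apply: t2; rewrite in_part2 // -yV1.
Qed.

(** Let [u w] be an edge leaving [A] at [u].  If [u] is in the part of [x], an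
    automorphism stabilising [A] moves [x] to [u], and the edge can be pulled back.
    Otherwise [w] is in the part of [x]; if [s] moves [x] to [w], then [s @: A] is not
    [A], so it is disjoint from [A], and the edge [w u] leaves [s @: A]: its preimage
    leaves [A] at [x]. *)
Lemma block_out_edges A x y : mg_connected G -> aut_block A ->
  x \in A -> y \notin A -> 0 < #|out_edges A x|.
Proof.
move=> conG blockA xA yA; apply/(out_edgesP xA).
have [u [w [uA wA uw]]] := boundary_exit (boundary_neq0 conG xA yA).
have [xu|xu] := eqVneq (x \in V1) (u \in V1).
  have [s auts sx] := part_transitive xu.
  have sA : s @: A = A.
    apply: blockA => //; apply/pred0Pn; exists u; rewrite /= uA andbT -sx.
    exact: imset_f.
  exists ((s^-1)%g w); last by rewrite -auts permKV sx.
  by apply: contra wA => /(imset_f s); rewrite permKV sA.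
have xw : (x \in V1) = (w \in V1).
  by have := mult_parts uw; move: xu; do 3!case: (_ \in V1).
have [s auts sx] := part_transitive xw.
have usA : u \notin s @: A.
  apply: contra wA => usA; rewrite -(blockA s auts) -?sx ?imset_f //.
  by apply/pred0Pn; exists u; rewrite /= uA usA.
exists ((s^-1)%g u).
  by apply: contra usA => /(imset_f s); rewrite permKV.
by rewrite -auts sx permKV /mult setUC.
Qed.

Lemma superatom_out_edges A x : mg_connected G -> superatom A ->
  x \in A -> 0 < #|out_edges A x|.
Proof.
move=> conG sA xA; have [/and3P[/eqP cA _ CA1] _] := sA.
have [y yA] : exists y, y \notin A.
  have /set0Pn[y] : ~: A != set0 by rewrite -card_gt0 ltnW.
  by rewrite inE; exists y.
have [blockA | [v [w [vw DA dv dw]]]] := superatom_block_or_pair sA.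
  exact: block_out_edges yA.
rewrite DA in xA cA yA *; case/set2P: xA => ->.
  by apply: pair_out_edges yA; rewrite ?cA.
by rewrite setUC in cA yA *; apply: pair_out_edges yA; rewrite 1?eq_sym ?cA.
Qed.

End HalfTransitive.

(** * Induced subgraphs *)

Section Induced.
Variables (G : mgraph) (A : {set vertex G}).
Let H := induced A.

Lemma ends_induced (e : edge H) : ends (val e) = val @: ends e.
Proof.
apply/setP=> x; apply/idP/imsetP => [xe|[y]]; last by rewrite !inE => ye ->.
by exists (Sub x (subsetP (valP e) x xe)); rewrite ?inE SubK.
Qed.

Lemma imset_val_pair (x y : vertex H) :
  val @: [set x; y] = [set val x; val y].
Proof. by rewrite imsetU1 imset_set1. Qed.

Lemma card_induced_edges (P : pred (edge G)) :
  #|[set e : edge H | P (val e)]| = #|[set e | (ends e \subset A) && P e]|.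
Proof.
rewrite -(card_imset _ val_inj); apply: eq_card => e; rewrite inE.
apply/imsetP/andP => [[e' + ->]|[eA Pe]]; first by rewrite inE (valP e').
by exists (Sub e eA); rewrite ?inE SubK.
Qed.

Lemma mult_induced (x y : vertex H) : mult x y = mult (val x) (val y).
Proof.
rewrite /mult; pose P e := ends e == [set val x; val y].
rewrite (_ : #|_| = #|[set e : edge H | P (val e)]|).
  rewrite card_induced_edges; apply: eq_card => e; rewrite !inE /P andb_idl //.
  by move=> /eqP->; rewrite subUset !sub1set (valP x) (valP y).
apply: eq_card => e; rewrite !inE /P ends_induced -imset_val_pair.
by rewrite (inj_eq (imset_inj val_inj)).
Qed.

Lemma degree_induced (x : vertex H) :
  degree (val x) = degree x + #|out_edges A (val x)|.
Proof.
rewrite /degree (_ : #|incident_edges x| =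
    #|[set e : edge H | val x \in ends (val e)]|); last first.
  by apply: eq_card => e; rewrite !inE.
rewrite (card_induced_edges (fun e => val x \in ends e)) addnC.
rewrite -(cardsID (boundary A) (incident_edges (val x))); congr (_ + _).
apply: eq_card => e; rewrite in_setD !inE andbC [RHS]andbC.
have [xe|] //= := boolP (val x \in ends e).
rewrite [ends e \subset ~: A](_ : _ = false) ?andbT ?negbK //.
by apply/negP=> /subsetP/(_ _ xe); rewrite inE (valP x).
Qed.

(** A set [X] of vertices of [H] without boundary in [H] splits the boundary of [A]
    into those of [X] and [A :\: X], each at least the edge connectivity. *)
Lemma connected_induced : A != setT -> 0 < edge_connectivity G ->
  #|boundary A| = edge_connectivity G -> mg_connected H.
Proof.
move=> AT pos cA; apply/negPn/negP => /disconnecting_boundary[X [X0 XT bX]].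
pose Y : {set vertex G} := val @: X.
have sYA : Y \subset A by apply/subsetP=> _ /imsetP[x _ ->]; exact: (valP x).
have Y0 : Y != set0 by rewrite imset_eq0.
have D0 : A :\: Y != set0.
  move: XT; rewrite -subTset => /subsetPn[y _ yX]; apply: (@neq_set0 _ _ (val y)).
  by rewrite inE (mem_imset _ _ val_inj) yX (valP y).
have neqT (Z : {set vertex G}) : Z \subset A -> Z != setT.
  by apply: contraTneq => ->; rewrite subTset.
have : #|boundary Y| + #|boundary (A :\: Y)| <= #|boundary A|.
  rewrite !card_edges -big_split; apply: leq_sum => e _ /=.
  have [x [y [_ De]]] := ends_pair e; rewrite !(in_boundary _ De) !inE.
  have [xA|xA] := boolP (x \in A); have [yA|yA] := boolP (y \in A) => /=.
  - have eA : ends e \subset A by rewrite De subUset !sub1set xA.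
    pose x' : vertex H := Sub x xA; pose y' : vertex H := Sub y yA.
    pose e' : edge H := Sub e eA.
    have De' : ends e' = [set x'; y'].
      apply: (imset_inj val_inj); rewrite -ends_induced imset_val_pair.
      by rewrite !SubK.
    have : e' \notin boundary X by apply/negP=> /(subsetP bX); rewrite inE.
    rewrite (in_boundary _ De').
    rewrite -[x]/(val x') -[y]/(val y') !(mem_imset _ _ val_inj).
    by case: (x' \in X); case: (y' \in X).
  - by rewrite (contraNF (subsetP sYA y) yA); case: (x \in Y).
  - by rewrite (contraNF (subsetP sYA x) xA); case: (y \in Y).
  - by rewrite (contraNF (subsetP sYA x) xA) (contraNF (subsetP sYA y) yA).
have := connectivity_le_boundary Y0 (neqT Y sYA).
have := connectivity_le_boundary D0 (neqT _ (subsetDl A Y)).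
lia.
Qed.

(** An automorphism taking a vertex of the block [A] to another one stabilises [A],
    and so restricts to the induced subgraph. *)
Lemma aut_transitive_induced (V : {set vertex G}) :
  aut_block A -> aut_transitive_on V -> @aut_transitive_on H (ind_part A V).
Proof.
move=> blockA tV x y; rewrite !inE => xV yV.
have [s auts sx] := tV _ _ xV yV.
have sA : s @: A = A.
  apply: blockA => //; apply/pred0Pn; exists (val y); rewrite /= (valP y) andbT -sx.
  by rewrite imset_f // (valP x).
have sP (z : vertex H) : s (val z) \in A by have := imset_f s (valP z); rewrite sA.
pose f z : vertex H := Sub (s (val z)) (sP z).
have f_inj : injective f.
  by move=> z t /(congr1 val); rewrite !SubK => /perm_inj/val_inj.
exists (perm f_inj); last by apply: val_inj; rewrite permE SubK.
by move=> z t; rewrite !mult_induced !permE !SubK auts.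
Qed.

Lemma bipartition_induced (V1 V2 : {set vertex G}) :
    bipartition V1 V2 -> V1 :&: A != set0 -> V2 :&: A != set0 ->
  @bipartition H (ind_part A V1) (ind_part A V2).
Proof.
move=> [_ _ UT dis bip] /set0Pn[x1 /setIP[x1V x1A]] /set0Pn[x2 /setIP[x2V x2A]].
split.
- by apply: (@neq_set0 _ _ (Sub x1 x1A : vertex (induced A))); rewrite inE SubK.
- by apply: (@neq_set0 _ _ (Sub x2 x2A : vertex (induced A))); rewrite inE SubK.
- by apply/setP=> x; have := in_setT (val x); rewrite -UT !inE.
- rewrite disjoint_subset; apply/subsetP=> x; rewrite !inE => xV1.
  by rewrite (disjointFr dis xV1).
move=> e; have [x [y [xV1 yV2 De]]] := bip (val e).
have xA : x \in A by apply: (subsetP (valP e)); rewrite De !inE eqxx.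
have yA : y \in A by apply: (subsetP (valP e)); rewrite De !inE eqxx orbT.
exists (Sub x xA : vertex H), (Sub y yA : vertex H); rewrite !inE !SubK; split=> //.
by apply: (imset_inj val_inj); rewrite -ends_induced imset_val_pair !SubK.
Qed.

End Induced.

(** * The characterisation *)

Section Characterisation.
Variables (G : mgraph) (V1 V2 : {set vertex G}).
Hypothesis Gconn : mg_connected G.
Hypothesis Ghalf : half_transitive V1 V2.
Implicit Types (A : {set vertex G}).

Lemma parts_neq : exists x y, [/\ x \in V1, y \in V2 & x != y].
Proof.
have [[/set0Pn[x xV1] /set0Pn[y yV2] _ dis _] _ _] := Ghalf.
by exists x, y; split=> //; apply: contraTneq yV2 => <-; rewrite (disjointFr dis xV1).
Qed.

Lemma connectivity_le_min_degree d1 d2 :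
    (forall v, v \in V1 -> degree v = d1) ->
    (forall v, v \in V2 -> degree v = d2) ->
  edge_connectivity G <= minn d1 d2.
Proof.
move=> deg1 deg2; have [x [y [xV1 yV2 xy]]] := parts_neq.
rewrite leq_min -(deg1 _ xV1) -(deg2 _ yV2) /degree -!boundary1.
rewrite !connectivity_le_boundary //.
- by apply: (@neq_set0 _ _ y); rewrite inE.
- by apply: (@neq_setT _ _ x); rewrite inE.
- by apply: (@neq_set0 _ _ x); rewrite inE.
- by apply: (@neq_setT _ _ y); rewrite inE eq_sym.
Qed.

Lemma card_boundary_regular A d1 d2 d1' d2' :
    (forall v, v \in V1 -> degree v = d1) ->
    (forall v, v \in V2 -> degree v = d2) ->
    (forall x : vertex (induced A), val x \in V1 :&: A -> degree x = d1') ->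
    (forall x : vertex (induced A), val x \in V2 :&: A -> degree x = d2') ->
  #|boundary A| = #|V1 :&: A| * (d1 - d1') + #|V2 :&: A| * (d2 - d2').
Proof.
move=> deg1 deg2 deg1' deg2'.
rewrite card_boundary_out (bigID (mem V1)) /= -!sum_nat_const.
congr (_ + _); apply: eq_big => [x|x /andP[xA]]; rewrite ?(inE, in_part2 Ghalf) 1?andbC //.
  move=> xV1; have := degree_induced (Sub x xA : vertex (induced A)).
  by rewrite SubK deg1 // deg1' ?SubK ?inE ?xV1 // => ->; rewrite addKn.
move=> xV1; have := degree_induced (Sub x xA : vertex (induced A)).
have xV2 : x \in V2 by rewrite (in_part2 Ghalf).
by rewrite SubK deg2 // deg2' ?SubK ?inE ?xV2 // => ->; rewrite addKn.
Qed.

Lemma superatom_connected A : superatom A -> mg_connected (induced A).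
Proof.
case=> /and3P[/eqP cA _ CA1] _; have [x [y [_ _ xy]]] := parts_neq.
apply: connected_induced cA; last exact: connectivity_gt0 xy Gconn.
have /set0Pn[z] : ~: A != set0 by rewrite -card_gt0 ltnW.
by rewrite inE => /neq_setT.
Qed.

(** A connected graph on two or more vertices has an edge, and an edge has one end in
    each part. *)
Lemma superatom_meets_parts A : superatom A ->
  exists x1 x2, [/\ x1 \in V1, x2 \in V2, x1 \in A & x2 \in A].
Proof.
move=> sA; have [/and3P[_ /card_gt1P[x [y [xA yA xy]]] _] _] := sA.
pose x' : vertex (induced A) := Sub x xA; pose y' : vertex (induced A) := Sub y yA.
have xy' : y' \notin [set x'] by rewrite inE -val_eqE /= eq_sym.
have [u [w [_ _ uw]]] :=
  boundary_exit (boundary_neq0 (superatom_connected sA) (set11 x') xy').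
rewrite mult_induced in uw; have := mult_parts Ghalf uw.
have [uV1|uV1] := boolP (val u \in V1); have [wV1|wV1] := boolP (val w \in V1) => // _.
  by exists (val u), (val w); rewrite (in_part2 Ghalf) !(valP u, valP w).
by exists (val w), (val u); rewrite (in_part2 Ghalf) !(valP u, valP w).
Qed.

Lemma superatom_half_transitive A : superatom A ->
  @half_transitive (induced A) (ind_part A V1) (ind_part A V2).
Proof.
move=> sA; have [x1 [x2 [x1V1 x2V2 x1A x2A]]] := superatom_meets_parts sA.
have [bipG tG1 tG2] := Ghalf.
(* When [A] is a pair, this makes the identity the only automorphism needed. *)
have one_per_part p q x y : A = [set p; q] -> x \in A -> y \in A ->
    (x \in V1) = (y \in V1) -> x = y.
  have parts : (x1 \in V1) && (x2 \notin V1) by rewrite x1V1 -(in_part2 Ghalf).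
  move: x1A x2A => + + DA; rewrite DA => /set2P E1 /set2P E2.
  by move=> /set2P[]-> /set2P[]-> // E; case: E1 E2 parts => -> [] ->;
     rewrite ?E ?andbN // -?E ?andbN.
split.
- by apply: bipartition_induced => //; [apply: (@neq_set0 _ _ x1) | apply: (@neq_set0 _ _ x2)];
     apply/setIP.
- have [blockA|[p [q [pq DA _ _]]]] := superatom_block_or_pair sA.
    exact: aut_transitive_induced.
  move=> x y; rewrite !inE => xV yV; exists 1%g; first by move=> ? ?; rewrite !perm1.
  rewrite perm1; apply/val_inj/(one_per_part p q); rewrite ?(valP x) ?(valP y) //.
  by rewrite xV yV.
- have [blockA|[p [q [pq DA _ _]]]] := superatom_block_or_pair sA.
    exact: aut_transitive_induced.
  move=> x y; rewrite !inE !(in_part2 Ghalf) => xV yV; exists 1%g.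
    by move=> ? ?; rewrite !perm1.
  rewrite perm1; apply/val_inj/(one_per_part p q); rewrite ?(valP x) ?(valP y) //.
  by rewrite (negPf xV) (negPf yV).
Qed.

(** Otherwise every vertex of [A] other than [w] is joined to [w] by an edge that
    leaves [A].  As [A] has a vertex other than [w], this puts [w] outside [A]; then
    [w] is joined to a vertex of its own part. *)
Lemma boundary_not_incident A w x1 x2 :
    x1 \in V1 -> x2 \in V2 -> x1 \in A -> x2 \in A ->
    (forall x, x \in A -> 0 < #|out_edges A x|) ->
  boundary A <> incident_edges w.
Proof.
rewrite (in_part2 Ghalf) => x1V1 x2V1 x1A x2A out_gt0 Dw.
(* The two ends of the edge leaving [A] at [u] are [u] and [w]. *)
have joined u : u \in A -> u != w -> 0 < mult u w /\ w \notin A.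
  move=> uA uw; have /card_gt0P[e /setIP[eu eA]] := out_gt0 u uA.
  have ew : e \in incident_edges w by rewrite -Dw.
  rewrite !inE in eu ew.
  have De : ends e = [set u; w].
    by apply/esym/eqP; rewrite eqEcard subUset !sub1set eu ew cards2 uw card_ends.
  split; last by rewrite (in_boundary _ De) uA in eA.
  by apply/card_gt0P; exists e; rewrite inE De.
have wA : w \notin A.
  have [x1w|x1w] := eqVneq x1 w; last by case: (joined x1).
  by case: (joined x2) => //; apply: contraNneq x2V1 => ->; rewrite -x1w.
have neq_w x : x \in A -> x != w by apply: contraTneq => ->.
have [wV1|wV1] := boolP (w \in V1).
  have [/(mult_parts Ghalf)] := joined _ x1A (neq_w _ x1A).
  by rewrite x1V1 wV1.
have [/(mult_parts Ghalf)] := joined _ x2A (neq_w _ x2A).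
by rewrite (negPf x2V1) (negPf wV1).
Qed.

End Characterisation.

Theorem theorem4p2 (G : mgraph) (V1 V2 : {set vertex G}) (d1 d2 : nat)
    (Gconn : mg_connected G)
    (Ghalf : half_transitive V1 V2)
    (deg1 : forall v, v \in V1 -> degree v = d1)
    (deg2 : forall v, v \in V2 -> degree v = d2)
    (cardG : 2 * minn d1 d2 + 2 <= #|vertex G|) :
  ~ super_edge_connected G <->
  exists A : {set vertex G}, exists d1' d2' : nat,
    let H := induced A in
    let A1 := V1 :&: A in
    let A2 := V2 :&: A in
    [/\ A \proper [set: vertex G],
        A1 != set0 /\ A2 != set0,
        mg_connected H,
        @half_transitive H (ind_part A V1) (ind_part A V2)
      & [/\ forall x : vertex H, val x \in A1 -> degree x = d1',
            forall x : vertex H, val x \in A2 -> degree x = d2',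
            d1' < d1,
            d2' < d2
          & #|A1| * (d1 - d1') + #|A2| * (d2 - d2') <= minn d1 d2]].
Proof.
have lambda_le := connectivity_le_min_degree Ghalf deg1 deg2.
split.
  move=> /superatom_exists[A sA]; have [/and3P[/eqP cA _ CA1] _] := sA.
  have [x1 [x2 [x1V1 x2V2 x1A x2A]]] := superatom_meets_parts Gconn Ghalf sA.
  have halfH := superatom_half_transitive Gconn Ghalf sA; have [_ tH1 tH2] := halfH.
  pose y1 : vertex (induced A) := Sub x1 x1A.
  pose y2 : vertex (induced A) := Sub x2 x2A.
  have deg1' (x : vertex (induced A)) : val x \in V1 :&: A -> degree x = degree y1.
    rewrite inE => /andP[xV1 _].
    have [||s auts <-] := tH1 y1 x; rewrite ?inE ?SubK //.
    by rewrite degree_aut.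
  have deg2' (x : vertex (induced A)) : val x \in V2 :&: A -> degree x = degree y2.
    rewrite inE => /andP[xV2 _].
    have [||s auts <-] := tH2 y2 x; rewrite ?inE ?SubK //.
    by rewrite degree_aut.
  exists A, (degree y1), (degree y2); split=> //.
  - have /set0Pn[z] : ~: A != set0 by rewrite -card_gt0 ltnW.
    by rewrite inE properT => /neq_setT.
  - by split; [apply: (@neq_set0 _ _ x1) | apply: (@neq_set0 _ _ x2)]; apply/setIP.
  - exact: (superatom_connected Gconn Ghalf sA).
  split=> //.
  - rewrite -(deg1 _ x1V1) (degree_induced y1) -[X in X < _]addn0 ltn_add2l.
    exact: (superatom_out_edges Ghalf Gconn sA x1A).
  - rewrite -(deg2 _ x2V2) (degree_induced y2) -[X in X < _]addn0 ltn_add2l.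
    exact: (superatom_out_edges Ghalf Gconn sA x2A).
  by rewrite -(card_boundary_regular Ghalf deg1 deg2 deg1' deg2') cA.
move=> [A [d1' [d2' [AT [A1n0 A2n0] _ _ [deg1' deg2' lt1 lt2 le]]]]] super.
rewrite -(card_boundary_regular Ghalf deg1 deg2 deg1' deg2') in le.
rewrite properT in AT.
have [x1 /setIP[x1V1 x1A]] := set0Pn _ A1n0; have [x2 /setIP[x2V2 x2A]] := set0Pn _ A2n0.
have out_gt0 x : x \in A -> 0 < #|out_edges A x|.
  move=> xA; have := degree_induced (Sub x xA : vertex (induced A)); rewrite SubK.
  have [xV1|xV1] := boolP (x \in V1).
    by rewrite deg1 // deg1' ?SubK ?inE ?xV1 // => E; rewrite E in lt1; lia.
  have xV2 : x \in V2 by rewrite (in_part2 Ghalf).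
  by rewrite deg2 // deg2' ?SubK ?inE ?xV2 // => E; rewrite E in lt2; lia.
have [a [b [_ _ ab]]] := parts_neq Ghalf.
have [F /[dup] minF [dF cF]] := min_edge_cut_exists ab.
have [v DF] := super F minF.
have dv : minn d1 d2 <= degree v.
  have [vV1|vV1] := boolP (v \in V1); first by rewrite deg1 // geq_minl.
  by rewrite deg2 ?(in_part2 Ghalf) // geq_minr.
have A0 := neq_set0 x1A.
have cA : #|boundary A| = edge_connectivity G.
  apply/eqP; rewrite eqn_leq connectivity_le_boundary // andbT.
  by rewrite -cF DF (leq_trans le).
have [|w Dw] := super (boundary A).
  by split=> //; apply: boundary_disconnecting A0 AT _.
exact: (boundary_not_incident Ghalf x1V1 x2V2 x1A x2A out_gt0 Dw).
Qed.
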